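(* Let $k\geq 2$ and $n\geq 1$ be integers, let $t_1,\dots,t_k$ be indeterminates, and work in the field $\mathbb{C}(t_1,\dots,t_k)$ of rational functions. Set $t_0=1$. Let $B_{k,n}=(b_{rs})_{1\le r,s\le n}$ be the $n\times n$ lower Hessenberg matrix with $$b_{rs}=\begin{cases} -t_2 & \text{if } s=r+1,\\[1mm] \dfrac{t_{r-s+1}}{t_2^{\,r-s}} & \text{if } 0\leq r-s<k,\\[2mm] 0 & \text{otherwise.}\end{cases}$$ (Thus the diagonal entries are $t_1$, the subdiagonal entries are $1$, and the entries with $r-s=d$, $2\le d\le k-1$, are $t_{d+1}/t_2^{d}$.) Then $$\det(B_{k,n})=F_{k,n+1}(t).$$
   Context: The generalized Fibonacci polynomials $F_{k,n}(t)$, $t=(t_1,\dots,t_k)$, are defined by $F_{k,n}(t)=0$ for $n<1$, $F_{k,1}(t)=1$, $F_{k,2}(t)=t_1$, and $F_{k,n+1}(t)=t_1F_{k,n}(t)+t_2F_{k,n-1}(t)+\cdots+t_kF_{k,n-k+1}(t)$ for $n\ge 1$. *)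

(* Defs.v *)
From HB Require Import structures.
From mathcomp Require Import all_boot all_order all_algebra.
From mathcomp Require Import mpoly.

Set Implicit Arguments.
Unset Strict Implicit.
Unset Printing Implicit Defensive.

Import Order.TTheory GRing.Theory Num.Theory.
Local Open Scope ring_scope.

(* fraction.v keeps this notation local. *)
Notation "x %:F" := (FracField.tofrac x) : ring_scope.

Section GeneralizedFibonacci.
Variables (C : idomainType) (k : nat).

(* t_j: t_0 = 1 and t_1, ..., t_k are 'X_0, ..., 'X_(k-1).  The value at j > k
   is junk. *)
Definition indet (j : nat) : {mpoly C[k]} :=
  if j is i.+1 then (if insub i is Some i' then 'X_(i' : 'I_k) else 0) else 1.

(* [:: F_{k,n}; F_{k,n-1}; ...; F_{k,1}]; nth returns 0 past the end, which is
   the value of F_{k,m} for m < 1. *)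
Fixpoint genfib_seq (n : nat) : seq {mpoly C[k]} :=
  match n with
  | 0 => [::]
  | 1 => [:: 1]
  | m.+1 => (\sum_(i < k) indet i.+1 * (genfib_seq m)`_i) :: genfib_seq m
  end.

Definition genfib (n : int) : {mpoly C[k]} :=
  if n is Posz m then (genfib_seq m)`_0 else 0.

Lemma indetS (i : 'I_k) : indet i.+1 = 'X_i.
Proof. by rewrite /indet valK. Qed.

Lemma genfib_lt1 (n : int) : n < 1 -> genfib n = 0.
Proof. by case: n => [[]|]. Qed.

Lemma genfib1 : genfib 1 = 1.
Proof. by []. Qed.

Lemma nth_genfib_seq (n i : nat) : (genfib_seq n)`_i = genfib (n%:Z - i%:Z).
Proof.
elim: n i => [|n IHn] [|i]; rewrite ?subr0 //.
have -> : n.+1%:Z - i.+1%:Z = n%:Z - i%:Z.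
  by rewrite -addn1 -[i.+1]addn1 !PoszD opprD addrACA subrr addr0.
by rewrite -IHn; case: n {IHn} => //=; rewrite !nth_nil.
Qed.

Lemma genfibS (n : int) : 1 <= n ->
  genfib (n + 1) = \sum_(1 <= j < k.+1) indet j * genfib (n - j%:Z + 1).
Proof.
case: n => [[|n]|] // _; rewrite -PoszD addn1 big_add1 big_mkord [LHS]/=.
apply: eq_bigr => i _; rewrite (nth_genfib_seq n.+1); congr (_ * genfib _).
by rewrite -[i.+1]addn1 PoszD opprD addrA subrK.
Qed.

Lemma genfib2 : (0 < k)%N -> genfib 2 = indet 1.
Proof.
move=> k_gt0; rewrite -[2]/(1 + 1 : int) genfibS // big_ltn //.
rewrite subrr add0r genfib1 mulr1 big_nat big1 ?addr0 // => j /andP[j_gt1 _].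
by rewrite genfib_lt1 ?mulr0 // -[ltRHS]add0r ltrD2r subr_lt0.
Qed.

(* Rows and columns are indexed from 0, which changes none of the conditions
   on r and s. *)
Definition hessB (n : nat) : 'M[{fraction {mpoly C[k]}}]_n :=
  \matrix_(r < n, s < n)
    if s == r.+1 :> nat then - (indet 2)%:F
    else if (s <= r)%N && (r - s < k)%N then
      (indet (r - s).+1)%:F / (indet 2)%:F ^+ (r - s)
    else 0.

End GeneralizedFibonacci.

(* Main.v *)
(* The vector v with entries v_i = F_{k,i+1} / t_2^i is annihilated by every row
   of B_{k,n} but the last one, whose product with v is F_{k,n+1} / t_2^(n-1);
   this is the Fibonacci recurrence.  Since v_0 = 1, replacing the first column
   of B_{k,n} by B_{k,n} v does not change the determinant.  The new first column
   has a single nonzero entry, at the bottom, and its minor is lower triangular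
   with the superdiagonal entries -t_2 on its diagonal. *)
Require Import Defs.
From HB Require Import structures.
From mathcomp Require Import all_boot all_order all_algebra.
From mathcomp Require Import reals complex mpoly.

Set Implicit Arguments.
Unset Strict Implicit.
Unset Printing Implicit Defensive.

Import Order.TTheory GRing.Theory Num.Theory.
Local Open Scope ring_scope.

Lemma det_lower_hessenberg (R : comNzRingType) (n : nat) (A : 'M[R]_n.+1)
    (v : 'cV[R]_n.+1) (c : R) :
  (forall r s : 'I_n.+1, (r.+1 < s)%N -> A r s = 0) ->
  v ord0 ord0 = 1 -> A *m v = c *: delta_mx ord_max ord0 ->
  \det A = c * \prod_(i < n) - A (widen_ord (leqnSn n) i) (lift ord0 i).
Proof.
move=> A_hess v0 Av.
(* [U] is the identity with first column [v], so multiplying by it on the right replaces the first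
   column of [A] by [A *m v]. *)
pose U : 'M[R]_n.+1 :=
  \matrix_(i, j) if j == ord0 then v i ord0 else (i == j)%:R.
have detU : \det U = 1.
  rewrite det_trig; last first.
    apply/is_trig_mxP => i j lt_ij; rewrite mxE -!val_eqE /= (ltn_eqF lt_ij).
    by rewrite gtn_eqF // (leq_ltn_trans _ lt_ij).
  by apply: big1 => i _; rewrite mxE; case: eqP => [->|_]; rewrite ?eqxx.
have AU0 i : (A *m U) i ord0 = c * (i == ord_max)%:R.
  transitivity ((A *m v) i ord0); last by rewrite Av !mxE eqxx andbT.
  by rewrite !mxE; apply: eq_bigr => j _; rewrite mxE eqxx.
have AUS i j : (A *m U) i (lift ord0 j) = A i (lift ord0 j).
  rewrite mxE (bigD1 (lift ord0 j)) //= mxE eqxx mulr1 big1 ?addr0 // => l.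
  by rewrite mxE /= => /negPf->; rewrite mulr0.
transitivity (\det (A *m U)); first by rewrite det_mulmx detU mulr1.
rewrite (expand_det_col _ ord0).
rewrite (bigD1 ord_max) //= [X in _ + X]big1 => [|i /negPf i_neq]; last first.
  by rewrite AU0 i_neq mulr0 mul0r.
rewrite addr0 AU0 eqxx mulr1 /cofactor det_trig; last first.
  apply/is_trig_mxP => i j lt_ij; rewrite !mxE -[RHS](A_hess (lift ord_max i) (lift ord0 j)).
    by have := AUS (lift ord_max i) j; rewrite mxE.
  by rewrite lift_max lift0 ltnS.
(* The cofactor sign [(-1) ^+ n] matches the signs of the [n] negated superdiagonal entries. *)
rewrite prodrN card_ord addn0; congr (_ * (_ * _)).
apply: eq_bigr => i _; rewrite !mxE.
have -> : widen_ord (leqnSn n) i = lift ord_max i.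
  by apply/val_inj/esym; exact: lift_max.
by have := AUS (lift ord_max i) i; rewrite mxE.
Qed.

(** The recurrence reindexed by [s = n - i], to match the entries of a row on and below the
    diagonal. *)
Lemma genfib_convolution (C : idomainType) (k n : nat) :
  genfib C k n.+2 =
    \sum_(s < n.+1 | (n - s < k)%N) indet C k (n - s).+1 * genfib C k s.+1.
Proof.
pose G i := indet C k i.+1 * genfib C k (n.+1%:Z - i%:Z).
transitivity (\sum_(i < n.+1 | (i < k)%N) G i).
  transitivity (\sum_(i < k) G i).
    by apply: eq_bigr => i _; rewrite /G -nth_genfib_seq.
  (* Over a common range the two sums differ only in terms with [i > n], where the Fibonacci index
     is below 1. *)
  rewrite (big_ord_widen (k + n.+1) G) ?leq_addr //.
  rewrite [RHS](big_ord_widen_cond (k + n.+1) (fun i => i < k)%N G) ?leq_addl //.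
  rewrite [RHS]big_mkcondr /=; apply: eq_bigr => i _.
  case: ltnP => // le_ni; rewrite /G genfib_lt1 ?mulr0 //.
  by rewrite (@le_lt_trans _ _ 0) // subr_le0.
rewrite [LHS](reindex_inj rev_ord_inj) /=.
apply: eq_big => s; rewrite subSS // => _.
rewrite /G /= subzn ?(leq_trans (leq_subr _ _)) // subSn ?leq_subr //.
by rewrite subKn // -ltnS.
Qed.

Lemma det_hessB (C : idomainType) (k n : nat) : (2 <= k)%N ->
  \det (hessB C k n) = (genfib C k n.+1)%:F.
Proof.
move=> k_ge2; case: n => [|n]; first by rewrite det_mx00 genfib1 rmorph1.
set q := (indet C k 2)%:F.
have q_neq0 : q != 0.
  (* Since [k >= 2], [indet C k 2] is a genuine variable and not the junk value 0. *)
  rewrite tofrac_eq0 (indetS C (Ordinal k_ge2)).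
  by rewrite -msize_poly_eq0 msizeX.
pose v : 'cV_n.+1 := \col_i ((genfib C k i.+1)%:F / q ^+ i).
rewrite (@det_lower_hessenberg _ _ _ v ((genfib C k n.+2)%:F / q ^+ n)).
- rewrite (eq_bigr (fun=> q)) => [|i _]; last by rewrite mxE /= eqxx opprK.
  by rewrite prodr_const card_ord divfK ?expf_neq0.
- move=> r s lt_rs; rewrite mxE gtn_eqF // leqNgt.
  by rewrite (ltn_trans _ lt_rs).
- by rewrite mxE genfib1 rmorph1 expr0 divr1.
apply/matrixP => r j; rewrite !mxE ord1 eqxx andbT.
(* On and below the diagonal, the denominators [q ^+ (r - s)] and [q ^+ s] combine to [q ^+ r],
   independent of [s]. *)
have conv : \sum_(s < n.+1 | (s <= r)%N) hessB C k n.+1 r s * v s ord0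
    = (genfib C k r.+2)%:F / q ^+ r.
  rewrite genfib_convolution rmorph_sum mulr_suml.
  pose G s := (indet C k (r - s).+1 * genfib C k s.+1)%:F / q ^+ r.
  rewrite [RHS](big_ord_widen_cond n.+1 (fun s => r - s < k)%N G) //.
  rewrite [RHS](eq_bigl (fun s : 'I__ => (s <= r) && (r - s < k))%N); last first.
    by move=> s; rewrite andbC.
  rewrite big_mkcondr; apply: eq_bigr => s le_sr; rewrite !mxE.
  rewrite ltn_eqF ?ltnS // le_sr /=; case: ifP => _; last by rewrite mul0r.
  by rewrite /G rmorphM mulrACA -invfM -exprD subnK.
rewrite (bigID (fun s : 'I__ => s <= r)%N) /=.
rewrite conv; case: (ltnP r n) => [lt_rn | le_nr].
  have -> : (r == ord_max) = false by rewrite -val_eqE /= ltn_eqF.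
  (* The superdiagonal term [- q * v_(r+1)] cancels [conv]; the last row has no such term. *)
  rewrite mulr0 (bigD1 (Ordinal (lt_rn : r.+1 < n.+1)%N)) /= ?ltnn //.
  rewrite [X in _ + (_ + X)]big1 => [|s /andP[s_gtr s_neq]]; last first.
    by rewrite mxE (negPf s_gtr) (negPf (s_neq : s != r.+1 :> nat)) mul0r.
  rewrite !mxE /= eqxx addr0 exprS invfM mulNr mulrCA (mulrA q).
  by rewrite mulfV // mul1r mulrC subrr.
have r_max : r = n :> nat by apply/anti_leq; rewrite le_nr -ltnS ltn_ord.
have -> : (r == ord_max) = true by rewrite -val_eqE /= r_max eqxx.
rewrite mulr1 r_max big1 ?addr0 // => s; rewrite -ltnNge => /leq_trans.
by move=> /(_ n); rewrite ltnn -ltnS ltn_ord => /(_ isT).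
Qed.

Theorem theorem2p5 (R : realType) (k n : nat) (hk : (2 <= k)%N)
    (hn : (1 <= n)%N) :
  \det (hessB R[i] k n) = (genfib R[i] k (n%:Z + 1))%:F.
Proof. by rewrite -PoszD addn1 det_hessB. Qed.
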